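(* Let $\psi:\mathbb{R}^2\to\mathbb{L}^4$ be given by $\psi(x,y)=(\cosh x,\sinh x,\cos y,\sin y)$, which is an isometric immersion of the Euclidean plane into $\mathbb{L}^4$ with image in $\Lambda^+$. For $\sigma\in C^\infty(\mathbb{R}^2)$ let $\psi_\sigma=e^{\sigma}\psi$, a spacelike immersion with image in $\Lambda^+$. Then $\psi_{\sigma}$ is totally umbilical in $\mathbb{L}^4$ if and only if $\sigma$ satisfies the system of partial differential equations $$ \sigma_{x}^{2}-\sigma_{y}^{2}-\sigma_{xx}+\sigma_{yy}=1,\qquad \sigma_{xy}=\sigma_{x}\sigma_{y}. $$
   Context: $\mathbb{L}^4$ is Lorentz-Minkowski spacetime: $\mathbb{R}^4$ with the metric $\langle\,,\,\rangle=-(dx_0)^2+(dx_1)^2+(dx_2)^2+(dx_3)^2$. $\Lambda^+=\{v\in\mathbb{L}^4:\langle v,v\rangle=0,\ v_0>0\}$. A smooth immersion of a surface into $\mathbb{L}^4$ is spacelike if the induced metric is Riemannian. Totally umbilical means $\mathrm{II}(X,Y)=\langle X,Y\rangle\mathbf{H}$ for all tangent $X,Y$, where $\langle X,Y\rangle$ is the metric induced by the immersion, $\mathrm{II}$ is the second fundamental form (the normal part of $\overline{\nabla}_XY$, $\overline\nabla$ the flat connection of $\mathbb{L}^4$) and $\mathbf{H}=\frac12\mathrm{tr}_{\langle\,,\,\rangle}\mathrm{II}$. Subscripts on $\sigma$ denote partial derivatives. *)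

(* Defs.v *)
(* Built on the Stdlib reals and Coquelicot. *)
From Stdlib Require Export Reals.
From Coquelicot Require Export Coquelicot.
Open Scope R_scope.

(** Functions on the plane are curried, as in Coquelicot's two-variable
    calculus. *)

Definition dx (s : R -> R -> R) : R -> R -> R :=
  fun x y => Derive (fun t => s t y) x.
Definition dy (s : R -> R -> R) : R -> R -> R :=
  fun x y => Derive (fun t => s x t) y.

(** [ex_diff_n s n x y] is pointwise in [(x, y)]; over all points it says that
    every iterated partial derivative of order at most [n] exists and is jointly
    continuous. *)
Definition smooth (s : R -> R -> R) : Prop :=
  forall (n : nat) (x y : R), ex_diff_n s n x y.

(** Lorentz-Minkowski spacetime, with the vector space structure of the
    product. *)

Definition L4 : NormedModule R_AbsRing :=
  prod_NormedModule R_AbsRing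
    (prod_NormedModule R_AbsRing
      (prod_NormedModule R_AbsRing R_NormedModule R_NormedModule)
      R_NormedModule)
    R_NormedModule.

Definition mkL4 (a b c d : R) : L4 := (a, b, c, d).
Definition c0 (v : L4) : R := fst (fst (fst v)).
Definition c1 (v : L4) : R := snd (fst (fst v)).
Definition c2 (v : L4) : R := snd (fst v).
Definition c3 (v : L4) : R := snd v.

Definition lorentz (v w : L4) : R :=
  - (c0 v * c0 w) + c1 v * c1 w + c2 v * c2 w + c3 v * c3 w.

Definition future_cone (v : L4) : Prop := lorentz v v = 0 /\ 0 < c0 v.

Definition smooth_map (f : R -> R -> L4) : Prop :=
  smooth (fun x y => c0 (f x y)) /\ smooth (fun x y => c1 (f x y)) /\
  smooth (fun x y => c2 (f x y)) /\ smooth (fun x y => c3 (f x y)).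

Definition Dx (f : R -> R -> L4) (x y : R) : L4 :=
  mkL4 (dx (fun x y => c0 (f x y)) x y) (dx (fun x y => c1 (f x y)) x y)
       (dx (fun x y => c2 (f x y)) x y) (dx (fun x y => c3 (f x y)) x y).
Definition Dy (f : R -> R -> L4) (x y : R) : L4 :=
  mkL4 (dy (fun x y => c0 (f x y)) x y) (dy (fun x y => c1 (f x y)) x y)
       (dy (fun x y => c2 (f x y)) x y) (dy (fun x y => c3 (f x y)) x y).

(** The differential of [f] at [(x, y)], applied to the tangent vector [v]. It
    is also the derivative of [f] along [v] for the flat connection of [L4]. *)
Definition df (f : R -> R -> L4) (x y : R) (v : R * R) : L4 :=
  plus (scal (fst v) (Dx f x y)) (scal (snd v) (Dy f x y)).

Definition metric (f : R -> R -> L4) (x y : R) (v w : R * R) : R :=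
  lorentz (df f x y v) (df f x y w).

Definition immersion (f : R -> R -> L4) : Prop :=
  smooth_map f /\
  forall (x y : R) (v : R * R), df f x y v = zero -> v = (0, 0).

Definition spacelike_immersion (f : R -> R -> L4) : Prop :=
  immersion f /\
  forall (x y : R) (v : R * R), v <> (0, 0) -> 0 < metric f x y v v.

(** Isometric for the Euclidean metric of the plane. *)
Definition isometric_immersion (f : R -> R -> L4) : Prop :=
  immersion f /\
  forall (x y : R) (v w : R * R),
    metric f x y v w = fst v * fst w + snd v * snd w.

Definition e1 : R * R := (1, 0).
Definition e2 : R * R := (0, 1).

(** Gram matrix of the induced metric in the coordinate frame, and the entries
    of its inverse. The latter are meaningful only where [gdet] is nonzero, in
    particular for spacelike immersions. *)
Definition g11 f x y : R := metric f x y e1 e1.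
Definition g12 f x y : R := metric f x y e1 e2.
Definition g22 f x y : R := metric f x y e2 e2.
Definition gdet f x y : R := g11 f x y * g22 f x y - g12 f x y * g12 f x y.
Definition gi11 f x y : R := g22 f x y / gdet f x y.
Definition gi12 f x y : R := - g12 f x y / gdet f x y.
Definition gi22 f x y : R := g11 f x y / gdet f x y.

(** Coordinates, in the frame [Dx f], [Dy f], of the part of [V] tangent to
    [f] at [(x, y)]. *)
Definition tangent_coords (f : R -> R -> L4) (x y : R) (V : L4) : R * R :=
  let a := lorentz V (df f x y e1) in
  let b := lorentz V (df f x y e2) in
  (gi11 f x y * a + gi12 f x y * b, gi12 f x y * a + gi22 f x y * b).

Definition normal_part (f : R -> R -> L4) (x y : R) (V : L4) : L4 :=
  minus V (df f x y (tangent_coords f x y V)).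

Lemma normal_part_orthogonal (f : R -> R -> L4) (x y : R) (V : L4) (w : R * R) :
  gdet f x y <> 0 -> lorentz (normal_part f x y V) (df f x y w) = 0.
Proof.
intros Hd.
assert (Hb : forall A B P Q c d,
  lorentz (minus V (plus (scal A P) (scal B Q))) (plus (scal c P) (scal d Q))
  = c * (lorentz V (plus (scal 1 P) (scal 0 Q)) -
         (A * lorentz (plus (scal 1 P) (scal 0 Q)) (plus (scal 1 P) (scal 0 Q))
          + B * lorentz (plus (scal 1 P) (scal 0 Q)) (plus (scal 0 P) (scal 1 Q))))
  + d * (lorentz V (plus (scal 0 P) (scal 1 Q)) -
         (A * lorentz (plus (scal 1 P) (scal 0 Q)) (plus (scal 0 P) (scal 1 Q))
          + B * lorentz (plus (scal 0 P) (scal 1 Q)) (plus (scal 0 P) (scal 1 Q))))).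
{ intros A B [[[p0 p1] p2] p3] [[[q0 q1] q2] q3] c d.
  destruct V as [[[v0 v1] v2] v3].
  cbv [lorentz c0 c1 c2 c3 minus plus opp scal mult]; simpl.
  unfold scal, plus, opp, mult; simpl. unfold mult; simpl. ring. }
unfold normal_part, df at 1 2. rewrite Hb.
change (plus (scal 1 (Dx f x y)) (scal 0 (Dy f x y))) with (df f x y e1).
change (plus (scal 0 (Dx f x y)) (scal 1 (Dy f x y))) with (df f x y e2).
fold (metric f x y e1 e1) (metric f x y e1 e2) (metric f x y e2 e2).
fold (g11 f x y) (g12 f x y) (g22 f x y).
unfold tangent_coords, gi11, gi12, gi22; simpl.
unfold gdet in *. field. exact Hd.
Qed.

(** Vector fields on the plane, in coordinates. *)

Definition smooth_field (X : R -> R -> R * R) : Prop :=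
  smooth (fun x y => fst (X x y)) /\ smooth (fun x y => snd (X x y)).

(** Normal part of the flat derivative, along [X], of the vector field [df Y]
    along [f]. *)
Definition second_form (f : R -> R -> L4) (X Y : R -> R -> R * R) (x y : R)
    : L4 :=
  normal_part f x y (df (fun u v => df f u v (Y u v)) x y (X x y)).

Definition E1 : R -> R -> R * R := fun _ _ => e1.
Definition E2 : R -> R -> R * R := fun _ _ => e2.

(** Trace with respect to the metric induced by [f] of the bilinear map [B] on
    vector fields. *)
Definition metric_trace (f : R -> R -> L4)
    (B : (R -> R -> R * R) -> (R -> R -> R * R) -> R -> R -> L4) (x y : R)
    : L4 :=
  plus (plus (scal (gi11 f x y) (B E1 E1 x y)) (scal (gi12 f x y) (B E1 E2 x y)))
       (plus (scal (gi12 f x y) (B E2 E1 x y)) (scal (gi22 f x y) (B E2 E2 x y))).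

Definition mean_curvature (f : R -> R -> L4) (x y : R) : L4 :=
  scal (1 / 2) (metric_trace f (second_form f) x y).

Definition totally_umbilical (f : R -> R -> L4) : Prop :=
  forall X Y : R -> R -> R * R, smooth_field X -> smooth_field Y ->
  forall x y : R,
    second_form f X Y x y
    = scal (metric f x y (X x y) (Y x y)) (mean_curvature f x y).

Definition psi (x y : R) : L4 := mkL4 (cosh x) (sinh x) (cos y) (sin y).

Definition psi_conf (sigma : R -> R -> R) (x y : R) : L4 :=
  scal (exp (sigma x y)) (psi x y).

(* Main.v *)
Require Import Defs.
From Stdlib Require Import FunctionalExtensionality Lra.

(** Since [psi] is null and [lorentz psi (Dx psi) = lorentz psi (Dy psi) = 0],
    the metric induced by [f = exp s * psi] is [exp (2 s)] times the Euclidean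
    one. For a conformal metric, umbilicity says that the normal parts of
    [f_xx - f_yy] and of [f_xy] vanish. Modulo tangent vectors these two are
    multiples of [f], which is itself normal and nonzero:
    [f_xy] is [(s_xy - s_x s_y) f], and [f_xx - f_yy] is
    [(1 - (s_x^2 - s_y^2 - s_xx + s_yy)) f], where the [1] comes from
    [psi_xx - psi_yy = psi]. *)

(** * Functions of finite differentiability class on the plane and their closure properties *)

Lemma fun2_ext (A : Type) (f g : R -> R -> A) :
  (forall x y, f x y = g x y) -> f = g.
Proof.
intros H. apply functional_extensionality; intros x.
apply functional_extensionality; intros y. apply H.
Qed.

(** Fixing the order allows induction: the partial derivatives of a function of class [S n] are of
    class [n], whereas [smooth] treats all orders at once. *)
Definition of_class (n : nat) (f : R -> R -> R) : Prop :=
  forall x y, ex_diff_n f n x y.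

Lemma of_class_S (n : nat) (f : R -> R -> R) :
  (forall x y, continuity_2d_pt f x y) ->
  (forall x y, ex_derive (fun t => f t y) x) ->
  (forall x y, ex_derive (fun t => f x t) y) ->
  of_class n (dx f) -> of_class n (dy f) -> of_class (S n) f.
Proof.
intros H1 H2 H3 H4 H5 x y.
split; [apply H1 | split; [apply H2 | split; [apply H3 | split]]].
- apply H4.
- apply H5.
Qed.

Lemma of_class_cont (n : nat) (f : R -> R -> R) (x y : R) :
  of_class n f -> continuity_2d_pt f x y.
Proof. intros H. specialize (H x y). destruct n; apply H. Qed.

Lemma of_class_ex_dx (n : nat) (f : R -> R -> R) (x y : R) :
  of_class (S n) f -> ex_derive (fun t => f t y) x.
Proof. intros H. apply (H x y). Qed.

Lemma of_class_ex_dy (n : nat) (f : R -> R -> R) (x y : R) :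
  of_class (S n) f -> ex_derive (fun t => f x t) y.
Proof. intros H. apply (H x y). Qed.

Lemma of_class_dx (n : nat) (f : R -> R -> R) :
  of_class (S n) f -> of_class n (dx f).
Proof. intros H x y. apply (H x y). Qed.

Lemma of_class_dy (n : nat) (f : R -> R -> R) :
  of_class (S n) f -> of_class n (dy f).
Proof. intros H x y. apply (H x y). Qed.

(** Needed for products: in [dx f * g] one factor is of class [n] as a derivative, while the
    underived factor is of class [S n] and has to be lowered before the induction hypothesis
    applies. *)
Lemma of_class_pred (n : nat) (f : R -> R -> R) :
  of_class (S n) f -> of_class n f.
Proof.
revert f; induction n as [|n IH]; intros f H.
- intros x y. split; [apply (of_class_cont _ _ _ _ H) | trivial].
- apply of_class_S; intros.
  + apply (of_class_cont _ _ _ _ H).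
  + apply (of_class_ex_dx _ _ _ _ H).
  + apply (of_class_ex_dy _ _ _ _ H).
  + apply IH, of_class_dx, H.
  + apply IH, of_class_dy, H.
Qed.

Lemma of_class_ext (n : nat) (f g : R -> R -> R) :
  (forall u v, f u v = g u v) -> of_class n f -> of_class n g.
Proof. intros E. rewrite (fun2_ext _ _ _ E). trivial. Qed.

Lemma of_class_const (n : nat) (c : R) : of_class n (fun _ _ => c).
Proof.
revert c; induction n as [|n IH]; intros c.
- intros x y. split; [apply continuity_2d_pt_const | trivial].
- apply of_class_S; intros.
  + apply continuity_2d_pt_const.
  + apply ex_derive_const.
  + apply ex_derive_const.
  + apply (of_class_ext _ (fun _ _ => 0)); [|apply IH].
    intros u v. symmetry. apply (Derive_const c).
  + apply (of_class_ext _ (fun _ _ => 0)); [|apply IH].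
    intros u v. symmetry. apply (Derive_const c).
Qed.

Lemma of_class_plus (n : nat) (f g : R -> R -> R) :
  of_class n f -> of_class n g -> of_class n (fun x y => f x y + g x y).
Proof.
revert f g; induction n as [|n IH]; intros f g Hf Hg.
- intros x y. split; [|trivial].
  apply continuity_2d_pt_plus; eapply of_class_cont; eassumption.
- apply of_class_S; intros.
  + apply continuity_2d_pt_plus; eapply of_class_cont; eassumption.
  + apply (ex_derive_plus (fun t => f t y) (fun t => g t y));
      eapply of_class_ex_dx; eassumption.
  + apply (ex_derive_plus (fun t => f x t) (fun t => g x t));
      eapply of_class_ex_dy; eassumption.
  + apply (of_class_ext _ (fun x y => dx f x y + dx g x y)).
    * intros u v. symmetry.
      apply (Derive_plus (fun t => f t v) (fun t => g t v));
        eapply of_class_ex_dx; eassumption.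
    * apply IH; apply of_class_dx; assumption.
  + apply (of_class_ext _ (fun x y => dy f x y + dy g x y)).
    * intros u v. symmetry.
      apply (Derive_plus (fun t => f u t) (fun t => g u t));
        eapply of_class_ex_dy; eassumption.
    * apply IH; apply of_class_dy; assumption.
Qed.

Lemma of_class_mult (n : nat) (f g : R -> R -> R) :
  of_class n f -> of_class n g -> of_class n (fun x y => f x y * g x y).
Proof.
revert f g; induction n as [|n IH]; intros f g Hf Hg.
- intros x y. split; [|trivial].
  apply continuity_2d_pt_mult; eapply of_class_cont; eassumption.
- apply of_class_S; intros.
  + apply continuity_2d_pt_mult; eapply of_class_cont; eassumption.
  + apply (ex_derive_mult (fun t => f t y) (fun t => g t y));
      eapply of_class_ex_dx; eassumption.
  + apply (ex_derive_mult (fun t => f x t) (fun t => g x t));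
      eapply of_class_ex_dy; eassumption.
  + apply (of_class_ext _ (fun x y => dx f x y * g x y + f x y * dx g x y)).
    * intros u v. symmetry.
      apply (Derive_mult (fun t => f t v) (fun t => g t v));
        eapply of_class_ex_dx; eassumption.
    * apply of_class_plus; apply IH;
        solve [apply of_class_dx; assumption | apply of_class_pred; assumption].
  + apply (of_class_ext _ (fun x y => dy f x y * g x y + f x y * dy g x y)).
    * intros u v. symmetry.
      apply (Derive_mult (fun t => f u t) (fun t => g u t));
        eapply of_class_ex_dy; eassumption.
    * apply of_class_plus; apply IH;
        solve [apply of_class_dy; assumption | apply of_class_pred; assumption].
Qed.

(** Exchanging the variables exchanges [dx] and [dy]. This carries smoothness of functions of the
    first variable over to functions of the second. *)
Lemma of_class_swap (n : nat) (f : R -> R -> R) :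
  of_class n f -> of_class n (fun x y => f y x).
Proof.
assert (Hc : forall g x y, continuity_2d_pt g y x ->
                           continuity_2d_pt (fun x y => g y x) x y).
{ intros g x y H eps. destruct (H eps) as [d Hd].
  exists d. intros u v Hu Hv. apply Hd; assumption. }
revert f; induction n as [|n IH]; intros f H.
- intros x y. split; [|trivial]. apply Hc, (of_class_cont _ _ _ _ H).
- apply of_class_S; intros.
  + apply Hc, (of_class_cont _ _ _ _ H).
  + apply (of_class_ex_dy _ _ _ _ H).
  + apply (of_class_ex_dx _ _ _ _ H).
  + apply (IH (dy f)), of_class_dy, H.
  + apply (IH (dx f)), of_class_dx, H.
Qed.

Lemma smooth_dx (f : R -> R -> R) : smooth f -> smooth (dx f).
Proof. intros H n. apply of_class_dx. intros x y. apply H. Qed.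

Lemma smooth_dy (f : R -> R -> R) : smooth f -> smooth (dy f).
Proof. intros H n. apply of_class_dy. intros x y. apply H. Qed.

Lemma smooth_ex_dx (f : R -> R -> R) (x y : R) :
  smooth f -> ex_derive (fun t => f t y) x.
Proof. intros H. apply (H 1%nat x y). Qed.

Lemma smooth_ex_dy (f : R -> R -> R) (x y : R) :
  smooth f -> ex_derive (fun t => f x t) y.
Proof. intros H. apply (H 1%nat x y). Qed.

Lemma smooth_cont (f : R -> R -> R) (x y : R) :
  smooth f -> continuity_2d_pt f x y.
Proof. intros H. apply (H 0%nat x y). Qed.

Lemma smooth_mult (f g : R -> R -> R) :
  smooth f -> smooth g -> smooth (fun x y => f x y * g x y).
Proof. intros Hf Hg n. apply of_class_mult; intros x y; [apply Hf | apply Hg]. Qed.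

(** * Differentiation rules, exponentials, and symmetry of mixed derivatives *)

Lemma dx_plus (f g : R -> R -> R) (x y : R) : smooth f -> smooth g ->
  dx (fun x y => f x y + g x y) x y = dx f x y + dx g x y.
Proof.
intros Hf Hg. apply (Derive_plus (fun t => f t y) (fun t => g t y));
  apply smooth_ex_dx; assumption.
Qed.

Lemma dy_plus (f g : R -> R -> R) (x y : R) : smooth f -> smooth g ->
  dy (fun x y => f x y + g x y) x y = dy f x y + dy g x y.
Proof.
intros Hf Hg. apply (Derive_plus (fun t => f x t) (fun t => g x t));
  apply smooth_ex_dy; assumption.
Qed.

Lemma dx_mult (f g : R -> R -> R) (x y : R) : smooth f -> smooth g ->
  dx (fun x y => f x y * g x y) x y = dx f x y * g x y + f x y * dx g x y.
Proof.
intros Hf Hg. apply (Derive_mult (fun t => f t y) (fun t => g t y));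
  apply smooth_ex_dx; assumption.
Qed.

Lemma dy_mult (f g : R -> R -> R) (x y : R) : smooth f -> smooth g ->
  dy (fun x y => f x y * g x y) x y = dy f x y * g x y + f x y * dy g x y.
Proof.
intros Hf Hg. apply (Derive_mult (fun t => f x t) (fun t => g x t));
  apply smooth_ex_dy; assumption.
Qed.

Lemma is_derive_exp_comp (h : R -> R) (x : R) : ex_derive h x ->
  is_derive (fun t => exp (h t)) x (exp (h x) * Derive h x).
Proof.
intros H. rewrite Rmult_comm.
apply (is_derive_comp exp h); [|apply Derive_correct, H].
apply is_derive_Reals, derivable_pt_lim_exp.
Qed.

Lemma dx_exp (f : R -> R -> R) (x y : R) : smooth f ->
  dx (fun x y => exp (f x y)) x y = exp (f x y) * dx f x y.
Proof.
intros H. apply is_derive_unique, (is_derive_exp_comp (fun t => f t y)).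
apply smooth_ex_dx, H.
Qed.

Lemma dy_exp (f : R -> R -> R) (x y : R) : smooth f ->
  dy (fun x y => exp (f x y)) x y = exp (f x y) * dy f x y.
Proof.
intros H. apply is_derive_unique, (is_derive_exp_comp (fun t => f x t)).
apply smooth_ex_dy, H.
Qed.

(** Each partial derivative of [exp f] is [exp f] times a smooth function, so class [n] of [exp f]
    itself yields class [S n]. *)
Lemma smooth_exp (f : R -> R -> R) :
  smooth f -> smooth (fun x y => exp (f x y)).
Proof.
intros H n.
assert (Hc : forall x y, continuity_2d_pt (fun x y => exp (f x y)) x y).
{ intros x y. apply continuity_1d_2d_pt_comp.
  - apply derivable_continuous_pt, derivable_pt_exp.
  - apply smooth_cont, H. }
induction n as [|n IH].
- intros x y. split; [apply Hc | trivial].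
- apply of_class_S; intros.
  + apply Hc.
  + eexists. apply (is_derive_exp_comp (fun t => f t y)), smooth_ex_dx, H.
  + eexists. apply (is_derive_exp_comp (fun t => f x t)), smooth_ex_dy, H.
  + apply (of_class_ext _ (fun x y => exp (f x y) * dx f x y)).
    * intros u v. symmetry. apply dx_exp, H.
    * apply of_class_mult; [exact IH | intros x y; apply smooth_dx, H].
  + apply (of_class_ext _ (fun x y => exp (f x y) * dy f x y)).
    * intros u v. symmetry. apply dy_exp, H.
    * apply of_class_mult; [exact IH | intros x y; apply smooth_dy, H].
Qed.

Lemma smooth_swap (f : R -> R -> R) : smooth f -> smooth (fun x y => f y x).
Proof. intros H n. apply of_class_swap. intros x y. apply H. Qed.

(* The span of [h] and [k] is stable under differentiation; this covers
   [cosh, sinh] with [e = 1] and [cos, - sin] with [e = -1]. *)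
Lemma smooth_of_second_order (h k : R -> R) (e a b : R) :
  (forall t, is_derive h t (k t)) -> (forall t, is_derive k t (e * h t)) ->
  smooth (fun x _ => a * h x + b * k x).
Proof.
intros Hh Hk n. revert a b.
assert (Hd : forall a b t,
  is_derive (fun t => a * h t + b * k t) t (b * e * h t + a * k t)).
{ intros a b t.
  replace (b * e * h t + a * k t) with (a * k t + b * (e * h t)) by ring.
  apply (is_derive_plus (fun t => a * h t) (fun t => b * k t));
    apply is_derive_scal; auto. }
assert (Hc : forall a b x y,
  continuity_2d_pt (fun x _ => a * h x + b * k x) x y).
{ intros a b x y.
  apply (continuity_1d_2d_pt_comp (fun t => a * h t + b * k t) (fun u _ => u)).
  - apply derivable_continuous_pt. eexists. apply is_derive_Reals, Hd.
  - apply continuity_2d_pt_id1. }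
induction n as [|n IH]; intros a b.
- intros x y. split; [apply Hc | trivial].
- apply of_class_S; intros.
  + apply Hc.
  + eexists. apply Hd.
  + apply ex_derive_const.
  + apply (of_class_ext _ (fun x _ => b * e * h x + a * k x)); [|exact (IH _ _)].
    intros u v. symmetry. apply is_derive_unique, Hd.
  + apply (of_class_ext _ (fun _ _ => 0)); [|apply of_class_const].
    intros u v. symmetry. apply (Derive_const (a * h u + b * k u)).
Qed.

Lemma smooth_schwarz (f : R -> R -> R) (x y : R) :
  smooth f -> dx (dy f) x y = dy (dx f) x y.
Proof.
intros H. apply Schwarz.
- apply locally_2d_forall. intros u v. repeat split.
  + apply smooth_ex_dx, H.
  + apply smooth_ex_dy, H.
  + apply (smooth_ex_dx (dy f)), smooth_dy, H.
  + apply (smooth_ex_dy (dx f)), smooth_dx, H.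
- apply (smooth_cont (dx (dy f))), smooth_dx, smooth_dy, H.
- apply (smooth_cont (dy (dx f))), smooth_dy, smooth_dx, H.
Qed.

(** * Coordinates and linear identities in [L4] *)

Lemma L4_eq (v w : L4) :
  c0 v = c0 w -> c1 v = c1 w -> c2 v = c2 w -> c3 v = c3 w -> v = w.
Proof.
destruct v as [[[v0 v1] v2] v3], w as [[[w0 w1] w2] w3].
unfold c0, c1, c2, c3; simpl. intros -> -> -> ->. reflexivity.
Qed.

Lemma c0_plus (v w : L4) : c0 (plus v w) = c0 v + c0 w.
Proof. reflexivity. Qed.
Lemma c1_plus (v w : L4) : c1 (plus v w) = c1 v + c1 w.
Proof. reflexivity. Qed.
Lemma c2_plus (v w : L4) : c2 (plus v w) = c2 v + c2 w.
Proof. reflexivity. Qed.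
Lemma c3_plus (v w : L4) : c3 (plus v w) = c3 v + c3 w.
Proof. reflexivity. Qed.

Lemma c0_minus (v w : L4) : c0 (minus v w) = c0 v - c0 w.
Proof. reflexivity. Qed.
Lemma c1_minus (v w : L4) : c1 (minus v w) = c1 v - c1 w.
Proof. reflexivity. Qed.
Lemma c2_minus (v w : L4) : c2 (minus v w) = c2 v - c2 w.
Proof. reflexivity. Qed.
Lemma c3_minus (v w : L4) : c3 (minus v w) = c3 v - c3 w.
Proof. reflexivity. Qed.

Lemma c0_scal (a : R) (v : L4) : c0 (scal a v) = a * c0 v.
Proof. reflexivity. Qed.
Lemma c1_scal (a : R) (v : L4) : c1 (scal a v) = a * c1 v.
Proof. reflexivity. Qed.
Lemma c2_scal (a : R) (v : L4) : c2 (scal a v) = a * c2 v.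
Proof. reflexivity. Qed.
Lemma c3_scal (a : R) (v : L4) : c3 (scal a v) = a * c3 v.
Proof. reflexivity. Qed.

Lemma c0_zero : c0 zero = 0.
Proof. reflexivity. Qed.
Lemma c1_zero : c1 zero = 0.
Proof. reflexivity. Qed.
Lemma c2_zero : c2 zero = 0.
Proof. reflexivity. Qed.
Lemma c3_zero : c3 zero = 0.
Proof. reflexivity. Qed.

Lemma c0_mkL4 (p q r s : R) : c0 (mkL4 p q r s) = p.
Proof. reflexivity. Qed.
Lemma c1_mkL4 (p q r s : R) : c1 (mkL4 p q r s) = q.
Proof. reflexivity. Qed.
Lemma c2_mkL4 (p q r s : R) : c2 (mkL4 p q r s) = r.
Proof. reflexivity. Qed.
Lemma c3_mkL4 (p q r s : R) : c3 (mkL4 p q r s) = s.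
Proof. reflexivity. Qed.

#[local] Hint Rewrite c0_plus c1_plus c2_plus c3_plus
  c0_minus c1_minus c2_minus c3_minus
  c0_scal c1_scal c2_scal c3_scal
  c0_zero c1_zero c2_zero c3_zero
  c0_mkL4 c1_mkL4 c2_mkL4 c3_mkL4 : coords.

Ltac coords := autorewrite with coords.

(** Replaces one atomic vector of a linear combination by a variable. [zero] and [mkL4] are kept
    because their coordinates enter the computation, and failing on variables lets the [repeat] in
    [L4_ring] stop. *)
Ltac generalize_leaf u :=
  lazymatch u with
  | plus ?v ?w => first [generalize_leaf v | generalize_leaf w]
  | minus ?v ?w => first [generalize_leaf v | generalize_leaf w]
  | scal _ ?v => generalize_leaf v
  | zero => fail
  | mkL4 _ _ _ _ => fail
  | _ => tryif is_var u then fail else (generalize u; intro)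
  end.

(* Without the generalization, comparing coordinates of compound vectors up to
   conversion is prohibitively slow. *)
Ltac L4_ring :=
  repeat match goal with
  | |- ?v = ?w => first [generalize_leaf v | generalize_leaf w]
  end;
  apply L4_eq; coords; ring.

(** * Calculus of maps from the plane to [L4] *)

Lemma smooth_map_scal (s : R -> R -> R) (f : R -> R -> L4) :
  smooth s -> smooth_map f -> smooth_map (fun x y => scal (s x y) (f x y)).
Proof.
intros ? (?&?&?&?). split; [|split; [|split]]; apply smooth_mult; trivial.
Qed.

Lemma smooth_map_Dx (f : R -> R -> L4) : smooth_map f -> smooth_map (Dx f).
Proof.
intros (H0&H1&H2&H3).
exact (conj (smooth_dx _ H0) (conj (smooth_dx _ H1)
  (conj (smooth_dx _ H2) (smooth_dx _ H3)))).
Qed.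

Lemma smooth_map_Dy (f : R -> R -> L4) : smooth_map f -> smooth_map (Dy f).
Proof.
intros (H0&H1&H2&H3).
exact (conj (smooth_dy _ H0) (conj (smooth_dy _ H1)
  (conj (smooth_dy _ H2) (smooth_dy _ H3)))).
Qed.

Lemma Dx_plus (f g : R -> R -> L4) (x y : R) : smooth_map f -> smooth_map g ->
  Dx (fun x y => plus (f x y) (g x y)) x y = plus (Dx f x y) (Dx g x y).
Proof.
intros (?&?&?&?) (?&?&?&?). unfold Dx. apply L4_eq; coords; apply dx_plus; trivial.
Qed.

Lemma Dy_plus (f g : R -> R -> L4) (x y : R) : smooth_map f -> smooth_map g ->
  Dy (fun x y => plus (f x y) (g x y)) x y = plus (Dy f x y) (Dy g x y).
Proof.
intros (?&?&?&?) (?&?&?&?). unfold Dy. apply L4_eq; coords; apply dy_plus; trivial.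
Qed.

Lemma Dx_scal (s : R -> R -> R) (f : R -> R -> L4) (x y : R) :
  smooth s -> smooth_map f ->
  Dx (fun x y => scal (s x y) (f x y)) x y
  = plus (scal (dx s x y) (f x y)) (scal (s x y) (Dx f x y)).
Proof.
intros ? (?&?&?&?). unfold Dx. apply L4_eq; coords; apply dx_mult; trivial.
Qed.

Lemma Dy_scal (s : R -> R -> R) (f : R -> R -> L4) (x y : R) :
  smooth s -> smooth_map f ->
  Dy (fun x y => scal (s x y) (f x y)) x y
  = plus (scal (dy s x y) (f x y)) (scal (s x y) (Dy f x y)).
Proof.
intros ? (?&?&?&?). unfold Dy. apply L4_eq; coords; apply dy_mult; trivial.
Qed.

Lemma Dx_Dy (f : R -> R -> L4) (x y : R) :
  smooth_map f -> Dx (Dy f) x y = Dy (Dx f) x y.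
Proof.
intros (H0&H1&H2&H3).
apply L4_eq; [exact (smooth_schwarz _ x y H0) | exact (smooth_schwarz _ x y H1)
             | exact (smooth_schwarz _ x y H2) | exact (smooth_schwarz _ x y H3)].
Qed.

(** * Lorentz product, normal projection and second fundamental form *)

Lemma lorentz_lincomb_l (u v w : L4) (a b : R) :
  lorentz (plus (scal a u) (scal b v)) w = a * lorentz u w + b * lorentz v w.
Proof. unfold lorentz. coords. ring. Qed.

Lemma lorentz_sym (v w : L4) : lorentz v w = lorentz w v.
Proof. unfold lorentz. ring. Qed.

Lemma lorentz_plus_l (u v w : L4) :
  lorentz (plus u v) w = lorentz u w + lorentz v w.
Proof. unfold lorentz. coords. ring. Qed.

Lemma lorentz_scal_l (a : R) (v w : L4) :
  lorentz (scal a v) w = a * lorentz v w.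
Proof. unfold lorentz. coords. ring. Qed.

Lemma df_e1 (f : R -> R -> L4) (x y : R) : df f x y e1 = Dx f x y.
Proof. unfold df, e1; cbn [fst snd]. L4_ring. Qed.

Lemma df_e2 (f : R -> R -> L4) (x y : R) : df f x y e2 = Dy f x y.
Proof. unfold df, e2; cbn [fst snd]. L4_ring. Qed.

Lemma normal_part_decomposition (f : R -> R -> L4) (x y : R) (V : L4) :
  V = plus (df f x y (tangent_coords f x y V)) (normal_part f x y V).
Proof. unfold normal_part. L4_ring. Qed.

(** Pairing [V] with the frame kills [W], so the Gram system that defines [tangent_coords] is solved
    by [w], and uniquely since [gdet] is nonzero. Normal parts can thus be computed by exhibiting a
    decomposition. *)
Lemma normal_part_unique (f : R -> R -> L4) (x y : R) (V W : L4) (w : R * R) :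
  gdet f x y <> 0 -> V = plus (df f x y w) W ->
  lorentz W (Dx f x y) = 0 -> lorentz W (Dy f x y) = 0 ->
  normal_part f x y V = W.
Proof.
intros Hd -> H1 H2.
assert (Ht : tangent_coords f x y (plus (df f x y w) W) = w).
{ unfold tangent_coords.
  rewrite !lorentz_plus_l, df_e1, df_e2, H1, H2.
  unfold df. rewrite !lorentz_lincomb_l.
  rewrite (lorentz_sym (Dy f x y) (Dx f x y)).
  revert Hd. unfold gi11, gi12, gi22, gdet, g11, g12, g22, metric.
  rewrite df_e1, df_e2. intros Hd.
  destruct w as [w1 w2]; simpl. f_equal; field; exact Hd. }
unfold normal_part. rewrite Ht. L4_ring.
Qed.

Lemma normal_part_minus (f : R -> R -> L4) (x y : R) (V W : L4) :
  normal_part f x y (minus V W)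
  = minus (normal_part f x y V) (normal_part f x y W).
Proof.
assert (Hm : forall Z,
  lorentz (minus V W) Z = lorentz V Z - lorentz W Z).
{ intros Z. unfold lorentz. coords. ring. }
unfold normal_part, tangent_coords. rewrite !Hm.
unfold df; simpl. L4_ring.
Qed.

(* The derivatives of the coefficients of [Y] only contribute tangent terms, so
   the second form is tensorial and determined by the second derivatives of
   [f]. *)
Lemma second_form_frame (f : R -> R -> L4) (X Y : R -> R -> R * R) (x y : R) :
  smooth_map f -> smooth_field Y -> gdet f x y <> 0 ->
  second_form f X Y x y =
  plus (scal (fst (X x y) * fst (Y x y)) (normal_part f x y (Dx (Dx f) x y)))
    (plus (scal (fst (X x y) * snd (Y x y) + snd (X x y) * fst (Y x y))
             (normal_part f x y (Dy (Dx f) x y)))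
       (scal (snd (X x y) * snd (Y x y)) (normal_part f x y (Dy (Dy f) x y)))).
Proof.
intros Hf [HY1 HY2] Hd.
assert (HDx := smooth_map_Dx f Hf). assert (HDy := smooth_map_Dy f Hf).
unfold second_form.
set (X1 := fst (X x y)). set (X2 := snd (X x y)).
set (Y1 := fun u v => fst (Y u v)) in *. set (Y2 := fun u v => snd (Y u v)) in *.
set (t11 := tangent_coords f x y (Dx (Dx f) x y)).
set (t12 := tangent_coords f x y (Dy (Dx f) x y)).
set (t22 := tangent_coords f x y (Dy (Dy f) x y)).
assert (Hn : forall V, lorentz (normal_part f x y V) (Dx f x y) = 0 /\
                       lorentz (normal_part f x y V) (Dy f x y) = 0).
{ intros V. rewrite <- df_e1, <- df_e2.
  split; apply normal_part_orthogonal, Hd. }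
(* The proposed tangent part collects the derivatives along [X] of the coefficients of [Y] and the
   tangent components of the second derivatives of [f], weighted by the products of the coefficients
   of [X] and [Y]. *)
apply (normal_part_unique f x y _ _
  (X1 * dx Y1 x y + X2 * dy Y1 x y + X1 * Y1 x y * fst t11
     + (X1 * Y2 x y + X2 * Y1 x y) * fst t12 + X2 * Y2 x y * fst t22,
   X1 * dx Y2 x y + X2 * dy Y2 x y + X1 * Y1 x y * snd t11
     + (X1 * Y2 x y + X2 * Y1 x y) * snd t12 + X2 * Y2 x y * snd t22)).
- exact Hd.
- change (fun u v => df f u v (Y u v)) with
    (fun u v => plus (scal (Y1 u v) (Dx f u v)) (scal (Y2 u v) (Dy f u v))).
  assert (HA : smooth_map (fun u v => scal (Y1 u v) (Dx f u v))).
  { apply smooth_map_scal; trivial. }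
  assert (HB : smooth_map (fun u v => scal (Y2 u v) (Dy f u v))).
  { apply smooth_map_scal; trivial. }
  unfold df at 1.
  rewrite Dx_plus, Dy_plus, !Dx_scal, !Dy_scal, Dx_Dy by trivial.
  (* Only the second derivatives on the left are split; those inside [normal_part] on the right must
     stay. The mixed one occurs twice on the left, from differentiating [Dy f] along x and [Dx f]
     along y. *)
  rewrite (normal_part_decomposition f x y (Dx (Dx f) x y)) at 1.
  rewrite (normal_part_decomposition f x y (Dy (Dx f) x y)) at 1 2.
  rewrite (normal_part_decomposition f x y (Dy (Dy f) x y)) at 1.
  fold t11 t12 t22 X1 X2. unfold df. cbn [fst snd].
  change (fst (Y x y)) with (Y1 x y). change (snd (Y x y)) with (Y2 x y).
  L4_ring.
- rewrite !lorentz_plus_l, !lorentz_scal_l, !(fun V => proj1 (Hn V)). ring.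
- rewrite !lorentz_plus_l, !lorentz_scal_l, !(fun V => proj2 (Hn V)). ring.
Qed.

(** * Umbilicity for a conformal induced metric *)

Lemma smooth_field_const (v : R * R) : smooth_field (fun _ _ => v).
Proof. split; intros n x y; apply of_class_const. Qed.

Lemma metric_conformal_gram (f : R -> R -> L4) (x y l : R) :
  (forall v w, metric f x y v w = l * (fst v * fst w + snd v * snd w)) ->
  g11 f x y = l /\ g12 f x y = 0 /\ g22 f x y = l /\ gdet f x y = l * l.
Proof.
intros H. unfold gdet, g11, g12, g22. rewrite !H. unfold e1, e2; simpl.
repeat split; ring.
Qed.

Lemma second_form_coordinate_frame (f : R -> R -> L4) (x y : R) :
  smooth_map f -> gdet f x y <> 0 ->
  second_form f E1 E1 x y = normal_part f x y (Dx (Dx f) x y) /\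
  second_form f E1 E2 x y = normal_part f x y (Dy (Dx f) x y) /\
  second_form f E2 E1 x y = normal_part f x y (Dy (Dx f) x y) /\
  second_form f E2 E2 x y = normal_part f x y (Dy (Dy f) x y).
Proof.
intros Hf Hd.
assert (H1 : smooth_field E1) by apply smooth_field_const.
assert (H2 : smooth_field E2) by apply smooth_field_const.
rewrite !second_form_frame by assumption.
unfold E1, E2, e1, e2. cbn [fst snd].
repeat split; L4_ring.
Qed.

(** The inverse Gram matrix is the identity divided by [l], so the trace loses its mixed terms and
    the factor 1/2 gives [/ (2 * l)]. *)
Lemma mean_curvature_conformal (f : R -> R -> L4) (x y l : R) :
  smooth_map f -> 0 < l ->
  (forall v w, metric f x y v w = l * (fst v * fst w + snd v * snd w)) ->
  mean_curvature f x y =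
  scal (/ (2 * l)) (plus (normal_part f x y (Dx (Dx f) x y))
                         (normal_part f x y (Dy (Dy f) x y))).
Proof.
intros Hf Hl Hm.
destruct (metric_conformal_gram f x y l Hm) as (H11&H12&H22&Hd).
assert (Hd' : gdet f x y <> 0) by (rewrite Hd; nra).
destruct (second_form_coordinate_frame f x y Hf Hd') as (S11&S12&S21&S22).
unfold mean_curvature, metric_trace, gi11, gi12, gi22.
rewrite H11, H12, H22, Hd, S11, S12, S21, S22.
generalize (normal_part f x y (Dx (Dx f) x y)).
generalize (normal_part f x y (Dy (Dx f) x y)).
generalize (normal_part f x y (Dy (Dy f) x y)).
intros n22 n12 n11. apply L4_eq; coords; field; lra.
Qed.

(** On the coordinate frame umbilicity makes both diagonal values of the second form equal to [l]
    times the mean curvature, and the mixed value zero. Conversely, these relations on the frame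
    extend to all fields because the second form is tensorial. *)
Lemma totally_umbilical_conformal (f : R -> R -> L4) (l : R -> R -> R) :
  smooth_map f -> (forall x y, 0 < l x y) ->
  (forall x y v w,
     metric f x y v w = l x y * (fst v * fst w + snd v * snd w)) ->
  totally_umbilical f <->
  forall x y, normal_part f x y (minus (Dx (Dx f) x y) (Dy (Dy f) x y)) = zero /\
              normal_part f x y (Dy (Dx f) x y) = zero.
Proof.
intros Hf Hl Hm.
assert (Hd : forall x y, gdet f x y <> 0).
{ intros x y.
  destruct (metric_conformal_gram f x y _ (Hm x y)) as (_&_&_&->).
  specialize (Hl x y). nra. }
split.
- intros H x y. rewrite normal_part_minus.
  assert (H1 : smooth_field E1) by apply smooth_field_const.
  assert (H2 : smooth_field E2) by apply smooth_field_const.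
  destruct (second_form_coordinate_frame f x y Hf (Hd x y)) as (S11&S12&_&S22).
  destruct (metric_conformal_gram f x y _ (Hm x y)) as (G11&G12&G22&_).
  rewrite <- S11, <- S12, <- S22, !H by assumption.
  change (metric f x y (E1 x y) (E1 x y)) with (g11 f x y).
  change (metric f x y (E1 x y) (E2 x y)) with (g12 f x y).
  change (metric f x y (E2 x y) (E2 x y)) with (g22 f x y).
  rewrite G11, G12, G22.
  split; L4_ring.
- intros H X Y HX HY x y. destruct (H x y) as [Ha Hb].
  rewrite normal_part_minus in Ha.
  rewrite (mean_curvature_conformal f x y (l x y)), second_form_frame, Hm, Hb by auto.
  revert Ha.
  generalize (normal_part f x y (Dx (Dx f) x y)).
  generalize (normal_part f x y (Dy (Dy f) x y)).
  intros n22 n11 Ha.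
  (* Once the two diagonal normal parts agree, the mean curvature is [n22] divided by [l], and the
     factor [l] of the metric cancels. *)
  replace n11 with n22.
  + specialize (Hl x y). apply L4_eq; coords; field; lra.
  + transitivity (minus n11 (minus n11 n22)); [L4_ring | rewrite Ha; L4_ring].
Qed.

(** * The immersion [psi]: smoothness, derivatives and induced metric *)

Lemma is_derive_cosh (t : R) : is_derive cosh t (sinh t).
Proof. apply is_derive_Reals, derivable_pt_lim_cosh. Qed.

Lemma is_derive_sinh (t : R) : is_derive sinh t (cosh t).
Proof. apply is_derive_Reals, derivable_pt_lim_sinh. Qed.

Lemma smooth_hyperbolic (a b : R) : smooth (fun x _ => a * cosh x + b * sinh x).
Proof.
apply (smooth_of_second_order cosh sinh 1).
- apply is_derive_cosh.
- intros t. rewrite Rmult_1_l. apply is_derive_sinh.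
Qed.

Lemma smooth_trigonometric (a b : R) :
  smooth (fun _ y => a * cos y + b * - sin y).
Proof.
apply (smooth_swap (fun y _ => a * cos y + b * - sin y)).
apply (smooth_of_second_order cos (fun t => - sin t) (-1)).
- intros t. apply is_derive_Reals, derivable_pt_lim_cos.
- intros t. replace (-1 * cos t) with (- cos t) by ring.
  apply (is_derive_opp sin), is_derive_Reals, derivable_pt_lim_sin.
Qed.

Lemma smooth_ext (f g : R -> R -> R) :
  (forall x y, f x y = g x y) -> smooth f -> smooth g.
Proof. intros E. rewrite (fun2_ext _ _ _ E). trivial. Qed.

Lemma smooth_psi : smooth_map psi.
Proof.
split; [|split; [|split]]; unfold psi; cbn [c0 c1 c2 c3 mkL4 fst snd].
- apply (smooth_ext (fun x _ => 1 * cosh x + 0 * sinh x));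
    [intros; ring | apply smooth_hyperbolic].
- apply (smooth_ext (fun x _ => 0 * cosh x + 1 * sinh x));
    [intros; ring | apply smooth_hyperbolic].
- apply (smooth_ext (fun _ y => 1 * cos y + 0 * - sin y));
    [intros; ring | apply smooth_trigonometric].
- apply (smooth_ext (fun _ y => 0 * cos y + -1 * - sin y));
    [intros; ring | apply smooth_trigonometric].
Qed.

Lemma Dx_psi (x y : R) : Dx psi x y = mkL4 (sinh x) (cosh x) 0 0.
Proof.
apply L4_eq; coords.
- apply is_derive_unique, is_derive_cosh.
- apply is_derive_unique, is_derive_sinh.
- apply (Derive_const (cos y)).
- apply (Derive_const (sin y)).
Qed.

Lemma Dy_psi (x y : R) : Dy psi x y = mkL4 0 0 (- sin y) (cos y).
Proof.
apply L4_eq; coords.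
- apply (Derive_const (cosh x)).
- apply (Derive_const (sinh x)).
- apply is_derive_unique, is_derive_Reals, derivable_pt_lim_cos.
- apply is_derive_unique, is_derive_Reals, derivable_pt_lim_sin.
Qed.

Lemma DxDx_psi (x y : R) : Dx (Dx psi) x y = mkL4 (cosh x) (sinh x) 0 0.
Proof.
rewrite (fun2_ext _ _ _ Dx_psi). apply L4_eq; coords.
- apply is_derive_unique, is_derive_sinh.
- apply is_derive_unique, is_derive_cosh.
- apply (Derive_const 0).
- apply (Derive_const 0).
Qed.

Lemma DyDx_psi (x y : R) : Dy (Dx psi) x y = zero.
Proof.
rewrite (fun2_ext _ _ _ Dx_psi). apply L4_eq; coords.
- apply (Derive_const (sinh x)).
- apply (Derive_const (cosh x)).
- apply (Derive_const 0).
- apply (Derive_const 0).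
Qed.

Lemma DyDy_psi (x y : R) : Dy (Dy psi) x y = mkL4 0 0 (- cos y) (- sin y).
Proof.
rewrite (fun2_ext _ _ _ Dy_psi). apply L4_eq; coords.
- apply (Derive_const 0).
- apply (Derive_const 0).
- apply is_derive_unique, (is_derive_opp sin), is_derive_Reals,
    derivable_pt_lim_sin.
- apply is_derive_unique, is_derive_Reals, derivable_pt_lim_cos.
Qed.

(** Oriented, like [cos_sqr], as a rewriting rule for [ring], which then eliminates the squares of
    [cosh] and [cos] in favour of those of [sinh] and [sin]. *)
Lemma cosh_sqr (t : R) : cosh t * cosh t = 1 + sinh t * sinh t.
Proof.
assert (He : exp t * exp (- t) = 1) by (rewrite <- exp_plus, Rplus_opp_r; apply exp_0).
unfold cosh, sinh. nra.
Qed.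

Lemma cos_sqr (t : R) : cos t * cos t = 1 - sin t * sin t.
Proof. pose proof (sin2_cos2 t) as H. unfold Rsqr in H. lra. Qed.

Lemma cosh_gt_0 (t : R) : 0 < cosh t.
Proof.
pose proof (exp_pos t). pose proof (exp_pos (- t)). unfold cosh. lra.
Qed.

Lemma psi_null (x y : R) : lorentz (psi x y) (psi x y) = 0.
Proof.
unfold psi, lorentz. coords. ring [(cosh_sqr x) (cos_sqr y)].
Qed.

Lemma metric_psi (x y : R) (v w : R * R) :
  metric psi x y v w = fst v * fst w + snd v * snd w.
Proof.
unfold metric, df. rewrite Dx_psi, Dy_psi. unfold lorentz. coords.
ring [(cosh_sqr x) (cos_sqr y)].
Qed.

(** A positive multiple of the Euclidean metric is positive definite. Injectivity of the
    differential follows, since a vector in its kernel has length zero. *)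
Lemma spacelike_of_conformal (f : R -> R -> L4) (l : R -> R -> R) :
  smooth_map f -> (forall x y, 0 < l x y) ->
  (forall x y v w,
     metric f x y v w = l x y * (fst v * fst w + snd v * snd w)) ->
  spacelike_immersion f.
Proof.
intros Hf Hl Hm.
assert (Hs : forall x y v, v <> (0, 0) -> 0 < metric f x y v v).
{ intros x y [a b] Hv. rewrite Hm; simpl. apply Rmult_lt_0_compat; [apply Hl|].
  destruct (Req_dec a 0) as [->|Ha]; [|nra].
  destruct (Req_dec b 0) as [->|Hb]; [|nra]. now elim Hv. }
split; [split|]; trivial.
intros x y [a b] Hv.
assert (H0 : metric f x y (a, b) (a, b) = 0).
{ unfold metric. rewrite Hv. unfold lorentz. coords. ring. }
rewrite Hm in H0; cbn [fst snd] in H0. specialize (Hl x y).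
apply Rmult_integral in H0. f_equal; nra.
Qed.

(** * The rescaled immersion and the normal parts of its second derivatives *)

Section Conformal.

Variable s : R -> R -> R.
Hypothesis Hs : smooth s.

Lemma smooth_psi_conf : smooth_map (psi_conf s).
Proof. apply smooth_map_scal; [apply smooth_exp, Hs | apply smooth_psi]. Qed.

Lemma Dx_psi_conf (x y : R) :
  Dx (psi_conf s) x y
  = plus (scal (dx s x y) (psi_conf s x y)) (scal (exp (s x y)) (Dx psi x y)).
Proof.
unfold psi_conf at 1.
rewrite Dx_scal, dx_exp; auto using smooth_exp, smooth_psi.
unfold psi_conf. L4_ring.
Qed.

Lemma Dy_psi_conf (x y : R) :
  Dy (psi_conf s) x y
  = plus (scal (dy s x y) (psi_conf s x y)) (scal (exp (s x y)) (Dy psi x y)).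
Proof.
unfold psi_conf at 1.
rewrite Dy_scal, dy_exp; auto using smooth_exp, smooth_psi.
unfold psi_conf. L4_ring.
Qed.

Lemma metric_psi_conf (x y : R) (v w : R * R) :
  metric (psi_conf s) x y v w
  = exp (s x y) * exp (s x y) * (fst v * fst w + snd v * snd w).
Proof.
unfold metric, df. rewrite Dx_psi_conf, Dy_psi_conf, Dx_psi, Dy_psi.
unfold psi_conf, psi, lorentz. coords.
ring [(cosh_sqr x) (cos_sqr y)].
Qed.

(** Conceptually, differentiating [lorentz f f = 0] shows that a map into the light cone is
    orthogonal to its own derivatives; here the orthogonality is checked in coordinates. *)
Lemma psi_conf_normal (x y c : R) :
  lorentz (scal c (psi_conf s x y)) (Dx (psi_conf s) x y) = 0 /\
  lorentz (scal c (psi_conf s x y)) (Dy (psi_conf s) x y) = 0.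
Proof.
rewrite Dx_psi_conf, Dy_psi_conf, Dx_psi, Dy_psi.
unfold psi_conf, psi, lorentz. coords.
split; ring [(cosh_sqr x) (cos_sqr y)].
Qed.

Lemma gdet_psi_conf (x y : R) : gdet (psi_conf s) x y <> 0.
Proof.
destruct (metric_conformal_gram _ x y _ (metric_psi_conf x y)) as (_&_&_&->).
repeat apply Rmult_integral_contrapositive_currified; apply Rgt_not_eq, exp_pos.
Qed.

Lemma normal_part_DyDx_psi_conf (x y : R) :
  normal_part (psi_conf s) x y (Dy (Dx (psi_conf s)) x y)
  = scal (dy (dx s) x y - dx s x y * dy s x y) (psi_conf s x y).
Proof.
(* With [f = psi_conf s], differentiate [f_x = s_x f + e^s psi_x] in y and substitute
   [e^s psi_x = f_x - s_x f] and [psi_xy = 0]: [f_xy = s_y f_x + s_x f_y + (s_xy - s_x s_y) f]. *)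
apply (normal_part_unique _ x y _ _ (dy s x y, dx s x y));
  try apply gdet_psi_conf; try apply psi_conf_normal.
rewrite (fun2_ext _ _ _ Dx_psi_conf) at 1.
rewrite Dy_plus, !Dy_scal, dy_exp by
  auto using smooth_map_scal, smooth_exp, smooth_dx, smooth_psi_conf,
    smooth_map_Dx, smooth_psi.
unfold df; cbn [fst snd].
rewrite DyDx_psi, Dx_psi_conf, Dy_psi_conf. L4_ring.
Qed.

Lemma normal_part_DxDx_sub_DyDy_psi_conf (x y : R) :
  normal_part (psi_conf s) x y
    (minus (Dx (Dx (psi_conf s)) x y) (Dy (Dy (psi_conf s)) x y))
  = scal (1 - ((dx s x y) ^ 2 - (dy s x y) ^ 2
               - dx (dx s) x y + dy (dy s) x y)) (psi_conf s x y).
Proof.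
(* The same substitution gives [f_xx = 2 s_x f_x + (s_xx - s_x^2) f + e^s psi_xx], and likewise in
   y; the tangent terms of the difference are the witness. *)
apply (normal_part_unique _ x y _ _ (2 * dx s x y, - (2 * dy s x y)));
  try apply gdet_psi_conf; try apply psi_conf_normal.
rewrite (fun2_ext _ _ _ Dx_psi_conf) at 1. rewrite (fun2_ext _ _ _ Dy_psi_conf) at 1.
rewrite Dx_plus, Dy_plus, !Dx_scal, !Dy_scal, dx_exp, dy_exp by
  auto using smooth_map_scal, smooth_exp, smooth_dx, smooth_dy, smooth_psi_conf,
    smooth_map_Dx, smooth_map_Dy, smooth_psi.
unfold df; cbn [fst snd].
rewrite DxDx_psi, DyDy_psi, Dx_psi_conf, Dy_psi_conf, Dx_psi, Dy_psi.
unfold psi_conf, psi. L4_ring.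
Qed.

Lemma c0_psi_conf_gt_0 (x y : R) : 0 < c0 (psi_conf s x y).
Proof. apply Rmult_lt_0_compat; [apply exp_pos | apply cosh_gt_0]. Qed.

(** The time component of [psi_conf s] is positive, so the vector never vanishes. This turns the
    vector equations of umbilicity into scalar ones. *)
Lemma scal_psi_conf_eq_zero (x y c : R) :
  scal c (psi_conf s x y) = zero <-> c = 0.
Proof.
split.
- intros H. apply (f_equal c0) in H.
  change (c * c0 (psi_conf s x y) = 0) in H.
  pose proof (c0_psi_conf_gt_0 x y). nra.
- intros ->. exact (scal_zero_l (psi_conf s x y)).
Qed.

End Conformal.

Theorem mainTheorem11 :
  (isometric_immersion psi /\ forall x y : R, future_cone (psi x y)) /\
  forall sigma : R -> R -> R, smooth sigma ->
    spacelike_immersion (psi_conf sigma) /\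
    (forall x y : R, future_cone (psi_conf sigma x y)) /\
    (totally_umbilical (psi_conf sigma) <->
     forall x y : R,
       (dx sigma x y) ^ 2 - (dy sigma x y) ^ 2
         - dx (dx sigma) x y + dy (dy sigma) x y = 1 /\
       dy (dx sigma) x y = dx sigma x y * dy sigma x y).
Proof.
split; [split; [split|]|].
(* [psi] itself is the conformal case with constant factor 1. *)
- apply (spacelike_of_conformal psi (fun _ _ => 1)).
  + apply smooth_psi.
  + intros _ _. apply Rlt_0_1.
  + intros x y v w. rewrite metric_psi. ring.
- apply metric_psi.
- intros x y. split; [apply psi_null | apply cosh_gt_0].
- intros s Hs.
  assert (Hl : forall x y, 0 < exp (s x y) * exp (s x y)).
  { intros x y. apply Rmult_lt_0_compat; apply exp_pos. }
  assert (Hm := metric_psi_conf s Hs).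
  assert (Hf := smooth_psi_conf s Hs).
  split; [|split].
  + exact (spacelike_of_conformal _ _ Hf Hl Hm).
  + intros x y. split; [|apply c0_psi_conf_gt_0].
    unfold psi_conf.
    rewrite lorentz_scal_l, lorentz_sym, lorentz_scal_l, psi_null. ring.
  (* Both normal parts are multiples of the nonvanishing [psi_conf s]; setting the two coefficients
     to zero gives the two differential equations. *)
  + rewrite (totally_umbilical_conformal _ _ Hf Hl Hm).
    split; intros H x y; destruct (H x y) as [H1 H2].
    * rewrite normal_part_DxDx_sub_DyDy_psi_conf in H1 by exact Hs.
      rewrite normal_part_DyDx_psi_conf in H2 by exact Hs.
      apply scal_psi_conf_eq_zero in H1, H2. split; lra.
    * rewrite normal_part_DxDx_sub_DyDy_psi_conf by exact Hs.
      rewrite normal_part_DyDx_psi_conf by exact Hs.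
      rewrite !scal_psi_conf_eq_zero. split; lra.
Qed.
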